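(* Let $N\in\mathbb N$, $\delta=1/N$, and let $\mathbb W^\delta$ be the discretized $L^2$-Wasserstein distance associated with $\boldsymbol\Gamma(a,b)=\sqrt{ab}$. Then the positive solutions to $$\dot\rho_\kappa=-2\,\Delta^\delta_\kappa\Big(\frac{\sqrt{\rho_+\rho_-}-\rho}{\delta^2}\Big)\qquad(\kappa\in[N])$$ form a gradient flow of the discretized Fisher information $\mathcal F^\delta(\rho)=2\delta\sum_\kappa\Big(\frac{\sqrt{\rho_{\kappa+1}}-\sqrt{\rho_\kappa}}\delta\Big)^2$ with respect to $\mathbb W^\delta$, that is, the equation on $\mathcal P^\delta_{>0}$ is equivalently written as $$\dot\rho=\partial^\delta_-\Big(\boldsymbol\Gamma(\rho)\,\partial^\delta_+\Big(\frac{\partial\mathcal F^\delta}{\partial\rho}\Big)\Big)=-2\,\partial^\delta_-\Big(\sqrt{\rho\,\rho_+}\;\partial^\delta_+\Big(\frac{\Delta^\delta\sqrt\rho}{\sqrt\rho}\Big)\Big).$$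
   Context: $[N]=\mathbb Z/N\mathbb Z$ with cyclic indices. For $f:[N]\to\mathbb R$: $(f_\pm)_\kappa=f_{\kappa\pm1}$, $\partial^\delta_+f=(f_+-f)/\delta$, $\partial^\delta_-f=(f-f_-)/\delta$, $\Delta^\delta f=(f_++f_--2f)/\delta^2$ (value $\Delta^\delta_\kappa f$ at $\kappa$); products, quotients and square roots are componentwise. $\mathcal P^\delta_{>0}=\{\rho:[N]\to\mathbb R:\rho_\kappa>0\ \forall\kappa,\ \delta\sum_\kappa\rho_\kappa=1\}$; positive solutions take values in $\mathcal P^\delta_{>0}$. $\boldsymbol\Gamma(\rho)_\kappa=\boldsymbol\Gamma(\rho_\kappa,\rho_{\kappa+1})=\sqrt{\rho_\kappa\rho_{\kappa+1}}$. The variational derivative $\partial\mathcal E/\partial\rho$ is taken with respect to the scalar product $\langle f,g\rangle_\delta=\delta\sum_\kappa f_\kappa g_\kappa$, i.e. its value at $\kappa$ is $\delta^{-1}$ times the ordinary partial derivative of $\mathcal E$ with respect to $\rho_\kappa$. $\mathbb W^\delta$ (in the sense of Maas) is the distance induced by the Riemannian structure on $\mathcal P^\delta_{>0}$ in which a tangent vector $\dot\rho$ (with $\sum_\kappa\dot\rho_\kappa=0$) is represented as $\dot\rho=-\partial^\delta_-(\boldsymbol\Gamma(\rho)\partial^\delta_+\varphi)$, with $\varphi$ unique up to constants, and has squared length $\delta\sum_\kappa\boldsymbol\Gamma(\rho)_\kappa(\partial^\delta_+\varphi)_\kappa^2$. The gradient flow of a smooth functional $\mathcal E$ in this structure is $\dot\rho=\partial^\delta_-\big(\boldsymbol\Gamma(\rho)\,\partial^\delta_+(\partial\mathcal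 E/\partial\rho)\big)$. *)

(* Defs.v *)
From HB Require Import structures.
From mathcomp Require Import all_boot all_order all_algebra.
From mathcomp Require Import all_classical all_reals all_analysis.

Set Implicit Arguments.
Unset Strict Implicit.
Unset Printing Implicit Defensive.

Import Order.TTheory GRing.Theory Num.Theory.
Import numFieldNormedType.Exports.

Local Open Scope classical_set_scope.
Local Open Scope ring_scope.

(** Functions on the cycle [N] = Z/NZ are functions on 'I_N; the cyclic
    successor and predecessor of an index are [ordS] and [ord_pred]. *)

Section DifferenceOperators.
Context {R : realType} {N : nat}.
Implicit Types (d : R) (f rho : 'I_N -> R).

Definition dplus d f : 'I_N -> R := fun k => (f (ordS k) - f k) / d.

Definition dminus d f : 'I_N -> R := fun k => (f k - f (ord_pred k)) / d.

Definition laplace d f : 'I_N -> R :=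
  fun k => (f (ordS k) + f (ord_pred k) - 2 * f k) / d ^+ 2.

Definition pos_prob d : set ('I_N -> R) :=
  [set rho | (forall k, 0 < rho k) /\ d * \sum_k rho k = 1].

(** d^-1 times the ordinary partial derivative of E in the k-th coordinate. *)
Definition varder d (E : ('I_N -> R) -> R) rho : 'I_N -> R :=
  fun k => d^-1 *
    derive1 (fun s : R => E (fun j => if j == k then s else rho j)) (rho k).

End DifferenceOperators.

(** A Riemannian structure on a subset of an affine subspace of R^N, all of
    whose tangent spaces are the direction of that subspace. *)
Record riemannian (R : realType) (N : nat) := Riemannian {
  points : set ('I_N -> R);
  tangent : set ('I_N -> R);
  metric : ('I_N -> R) -> ('I_N -> R) -> ('I_N -> R) -> R
}.

Section Riemannian.
Context {R : realType} {N : nat}.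
Implicit Types (M : riemannian R N) (rho v : 'I_N -> R) (J : interval R).

(** The induced distance: infimum of the lengths of the C^1 curves in the
    manifold.  The curve is C^1 on the whole line, but only its restriction to
    [0, 1] has to stay in the manifold. *)
Definition riem_dist M (p q : 'I_N -> R) : \bar R :=
  ereal_inf [set l : \bar R | exists c dc : R -> 'I_N -> R,
    [/\ forall (t : R) k, is_derive t (1 : R) (c ^~ k) (dc t k),
        forall k, continuous (dc ^~ k),
        forall t : R, t \in `[0, 1] -> points M (c t),
        c 0 = p /\ c 1 = q &
        l = (\int[lebesgue_measure]_(t in `[(0 : R)%R, (1 : R)%R])
               (Num.sqrt (metric M (c t) (dc t) (dc t)))%:E)%E ]].

(** [v] represents the differential of [E] at [rho] for the metric of [M]. *)
Definition is_gradient M (E : ('I_N -> R) -> R) rho v : Prop :=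
  tangent M v /\
  forall w, tangent M w ->
    is_derive (0 : R) (1 : R) (fun t : R => E (fun k => rho k + t * w k))
      (metric M rho v w).

(** Curves defined on an arbitrary interval J (only the restriction of the
    curve to J matters): continuous on J, differentiable in its interior. *)
Definition gradient_flow M (E : ('I_N -> R) -> R) J (c : R -> 'I_N -> R)
    : Prop :=
  [/\ forall t, t \in J -> points M (c t),
      forall k, {within [set` J], continuous (c ^~ k)} &
      forall t : R, ([set` J])° t -> exists2 v : 'I_N -> R,
        forall k, is_derive t (1 : R) (c ^~ k) (- v k) & is_gradient M E (c t) v].

Definition positive_solution (d : R) (X : ('I_N -> R) -> 'I_N -> R) J
    (c : R -> 'I_N -> R) : Prop :=
  [/\ forall t, t \in J -> pos_prob d (c t),
      forall k, {within [set` J], continuous (c ^~ k)} &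
      forall t : R, ([set` J])° t ->
        forall k, is_derive t (1 : R) (c ^~ k) (X (c t) k)].

End Riemannian.

(** A Riemannian structure used as a function denotes its distance. *)
Coercion riem_dist : riemannian >-> Funclass.

Section Wasserstein.
Context {R : realType} {N : nat}.
Variables (Gam : R -> R -> R) (d : R).
Implicit Types (rho v phi : 'I_N -> R).

Definition mobility rho : 'I_N -> R := fun k => Gam (rho k) (rho (ordS k)).

Definition potential_of rho v phi : Prop :=
  forall k, v k = - dminus d (fun j => mobility rho j * dplus d phi j) k.

(** A tangent vector determines its potential up to an additive constant, on
    which [wmetric] does not depend. *)
Definition potential rho v : 'I_N -> R :=
  xget (fun=> 0) [set phi | potential_of rho v phi].

(** The polarization of the squared length
    d * \sum_k mobility rho k * (dplus d phi k) ^+ 2. *)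
Definition wmetric rho v w : R :=
  d * \sum_k mobility rho k * dplus d (potential rho v) k
                            * dplus d (potential rho w) k.

Definition wasserstein : riemannian R N :=
  Riemannian (pos_prob d) [set v | \sum_k v k = 0] wmetric.

Definition wflow (E : ('I_N -> R) -> R) rho : 'I_N -> R :=
  dminus d (fun k => mobility rho k * dplus d (varder d E rho) k).

End Wasserstein.

Arguments wasserstein {R} N Gam d.

Definition geomean {R : realType} (a b : R) : R := Num.sqrt (a * b).

Section Fisher.
Context {R : realType} {N : nat}.
Implicit Types (d : R) (rho : 'I_N -> R).

Definition fisher d rho : R :=
  2 * d * \sum_k ((Num.sqrt (rho (ordS k)) - Num.sqrt (rho k)) / d) ^+ 2.

Definition dlss d rho : 'I_N -> R := fun k =>
  - 2 * laplace d
    (fun j => (Num.sqrt (rho (ordS j) * rho (ord_pred j)) - rho j) / d ^+ 2) k.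

Definition dlss_potential_form d rho : 'I_N -> R := fun k =>
  - 2 * dminus d (fun j => Num.sqrt (rho j * rho (ordS j)) *
    dplus d (fun i => laplace d (fun l => Num.sqrt (rho l)) i
                      / Num.sqrt (rho i)) j) k.

End Fisher.

(* Main.v *)
Require Import Defs.
From HB Require Import structures.
From mathcomp Require Import all_boot all_order all_algebra.
From mathcomp Require Import all_classical all_reals all_analysis.
From mathcomp Require Import ring.

(** Write s for the componentwise square root of rho.

    The Fisher information is, up to a factor, the discrete Dirichlet energy
    of s.  By the chain rule and one summation by parts on the cycle, its
    derivative in a direction w is d * \sum_k V k * w k, where V is the
    function - 2 * (laplace d s / s) ([is_derive_fisher]).  So V is the
    variational derivative, and substituting it into the Wasserstein flow
    gives the form with the potential ([wflow_fisher]).  This form is the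
    fourth-order equation because the mobility s * s_+ cancels the
    denominators in the difference of laplace d s / s between j and ordS j;
    what remains telescopes:
      s_j s_{j+2} + s_j^2 - s_{j+1}^2 - s_{j-1} s_{j+1}
        = (s_j s_{j+2} - s_{j+1}^2) - (s_{j-1} s_{j+1} - s_j^2),
    a forward difference of sqrt (rho_+ rho_-) - rho
    ([dlss_potential_formE]).

    To say that a curve is a gradient flow one must know the gradient for the
    Wasserstein metric.  For any energy with variational derivative V, a vector
    v is the gradient exactly when V is a potential of v
    ([is_gradient_wasserstein]).  The reason is that, if phi is a potential of
    v, the metric pairs v with a tangent w to d * \sum_k phi k * w k
    ([wmetric_potential]), so the gradient condition says that phi and V agree
    against all tangent vectors.  Testing on the tangent vector with potential
    phi - V shows that its squared length vanishes, so phi - V is constant.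
    All this needs every tangent vector to have a potential: this is the
    solvability of a discrete elliptic equation on the cycle, which is integrated
    explicitly ([potential_exists]). *)

Import Order.TTheory GRing.Theory Num.Theory.
Import numFieldNormedType.Exports.

Local Open Scope classical_set_scope.
Local Open Scope ring_scope.

(** * Calculus on the cycle *)

Lemma sum_dminus (R : realType) (N : nat) (d : R) (f : 'I_N -> R) :
  \sum_k dminus d f k = 0.
Proof.
rewrite -mulr_suml sumrB [X in _ - X](reindex_inj (@ordS_inj N)) /=.
by under [X in _ - X]eq_bigr do rewrite ordSK; rewrite subrr mul0r.
Qed.

Lemma sum_by_parts (R : realType) (N : nat) (d : R) (f g : 'I_N -> R) :
  \sum_k f k * dminus d g k = - \sum_k dplus d f k * g k.
Proof.
rewrite /dminus /dplus.
under eq_bigr do rewrite mulrA mulrBr mulrBl.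
under [X in _ = - X]eq_bigr do rewrite mulrAC mulrBl mulrBl.
rewrite !sumrB opprB; congr (_ - _).
rewrite (reindex_inj (@ordS_inj N)) /=.
by apply: eq_bigr => k _; rewrite ordSK.
Qed.

(** The primitive is the partial sum from 0 to k - 1; its step from the last
    index back to 0 is right because the total sum vanishes. *)
Lemma cyclic_primitive (R : realType) (N : nat) (g : 'I_N -> R) :
  \sum_k g k = 0 -> exists f : 'I_N -> R, forall k, f (ordS k) - f k = g k.
Proof.
move=> g0; exists (fun k => \sum_(i < N | (i < k)%N) g i) => k.
have step : \sum_(i < N | (i < k.+1)%N) g i = g k + \sum_(i < N | (i < k)%N) g i.
  rewrite (bigD1 k) //=; congr (_ + _); apply: eq_bigl => i.
  by rewrite ltnS ltn_neqAle andbC.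
have [kN|Nk] := ltnP k.+1 N.
  by rewrite /= modn_small // step addrK.
have kE : k.+1 = N by apply/eqP; rewrite eqn_leq Nk ltn_ord.
have total : \sum_(i < N | (i < k.+1)%N) g i = 0.
  by rewrite -[RHS]g0; apply: eq_bigl => i; rewrite kE ltn_ord.
rewrite /= {1}kE modnn big_pred0_eq sub0r.
by apply/eqP; rewrite eq_sym -addr_eq0 -step total.
Qed.

(** * Potentials and gradients in the Wasserstein structure *)

(** The equation is integrated twice.  The flux q, that is the mobility times
    the increment of phi, is a primitive of - d * v, which exists since v has
    sum 0 and is unique up to a constant.  The constant is then fixed so that
    the flux over the mobility, hence the increment of phi, has sum 0 too. *)
Lemma potential_exists {R : realType} {N : nat} {Gam : R -> R -> R} {d : R}
    {rho v : 'I_N -> R} :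
  d != 0 -> (forall k, 0 < mobility Gam rho k) -> \sum_k v k = 0 ->
  exists phi, potential_of Gam d rho v phi.
Proof.
set m := mobility Gam rho => d0 m_gt0 v0.
have m0 k : m k != 0 by rewrite gt_eqF.
have [|q qE] := @cyclic_primitive R N (fun k => - d * v (ordS k)).
  move: v0; rewrite (reindex_inj (@ordS_inj N)) /= => v0.
  by rewrite -mulr_sumr v0 mulr0.
case: (pickP (@predT 'I_N)) => [i0 _|N0]; last first.
  by exists (fun=> 0) => k; have := N0 k.
pose M := \sum_k (m k)^-1.
have M0 : M != 0.
  rewrite gt_eqF // /M (bigD1 i0) //= ltr_wpDr ?invr_gt0 //.
  by apply: sumr_ge0 => k _; rewrite invr_ge0 ltW.
(* The mean of the flux weighted by the inverse mobilities. *)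
pose C := (\sum_k q k / m k) / M.
have [|phi phiE] := @cyclic_primitive R N (fun k => d * ((q k - C) / m k)).
  rewrite -mulr_sumr.
  under eq_bigr do rewrite mulrBl.
  by rewrite sumrB -mulr_sumr -/M divfK // subrr mulr0.
exists phi => k; rewrite /dminus /dplus -/m !phiE.
have := qE (ord_pred k); rewrite ord_predK => qk.
have -> : v k = - (q k - q (ord_pred k)) / d by rewrite qk; field.
by field; rewrite d0 !m0.
Qed.

(** The metric is defined through chosen potentials of both arguments; a
    summation by parts removes the one of w, and by symmetry of the form the one
    of v may be replaced by any other. *)
Lemma wmetric_potential {R : realType} {N : nat} {Gam : R -> R -> R} {d : R}
    {rho v w phi : 'I_N -> R} :
  d != 0 -> (forall k, 0 < mobility Gam rho k) ->
  potential_of Gam d rho v phi -> \sum_k w k = 0 ->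
  wmetric Gam d rho v w = d * \sum_k phi k * w k.
Proof.
move=> d0 m_gt0 vphi w0; rewrite /wmetric; congr (_ * _).
have vpsi : potential_of Gam d rho v (potential Gam d rho v).
  by apply: xgetPex; exists phi.
have wchi : potential_of Gam d rho w (potential Gam d rho w).
  by apply: xgetPex; exact: potential_exists.
set psi := potential _ _ _ v in vpsi *; set chi := potential _ _ _ w in wchi *.
(* The weak form of the equation of the potential. *)
have parts (u f g : 'I_N -> R) : potential_of Gam d rho u f ->
    \sum_k g k * u k = \sum_k mobility Gam rho k * dplus d f k * dplus d g k.
  move=> uf; under eq_bigr do rewrite uf mulrN.
  rewrite sumrN sum_by_parts opprK.
  by apply: eq_bigr => k _; rewrite mulrC.
rewrite -(parts _ _ _ vpsi) (parts _ _ _ vphi) (parts _ _ _ wchi).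
by apply: eq_bigr => k _; rewrite mulrAC.
Qed.

(** Existence is the representation of the metric by potentials.
    Uniqueness is the energy method: a gradient with potential phi is compared
    with V by testing on the tangent vector w whose potential is phi - V. *)
Lemma is_gradient_wasserstein (R : realType) (N : nat) (Gam : R -> R -> R)
    (d : R) (E : ('I_N -> R) -> R) (rho V v : 'I_N -> R) :
  0 < d -> (forall k, 0 < mobility Gam rho k) ->
  (forall w : 'I_N -> R, is_derive (0 : R) (1 : R)
     (fun t : R => E (fun k => rho k + t * w k)) (d * \sum_k V k * w k)) ->
  is_gradient (wasserstein N Gam d) E rho v <-> potential_of Gam d rho v V.
Proof.
move=> d_gt0 m_gt0 dE; have d0 : d != 0 by rewrite gt_eqF.
have tangentP u f : potential_of Gam d rho u f -> \sum_k u k = 0.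
  by move=> uf; under eq_bigr do rewrite uf; rewrite sumrN sum_dminus oppr0.
split=> [[/= v0 gradv]|vV]; last first.
  split=> [|w w0] /=; first exact: tangentP vV.
  by rewrite (wmetric_potential d0 m_gt0 vV).
have [phi vphi] := potential_exists d0 m_gt0 v0.
pose f k := phi k - V k.
pose w k := - dminus d (fun j => mobility Gam rho j * dplus d f j) k.
have wf : potential_of Gam d rho w f by [].
have w0 := tangentP _ _ wf.
have phiVw : \sum_k phi k * w k = \sum_k V k * w k.
  apply: (mulfI d0); rewrite -(wmetric_potential d0 m_gt0 vphi w0).
  have [_ <-] := gradv w w0; have [_ <-] := dE w; by [].
have energy0 : \sum_k mobility Gam rho k * dplus d f k ^+ 2 = 0.
  transitivity (\sum_k f k * w k).
    rewrite /w; under [RHS]eq_bigr do rewrite mulrN.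
    rewrite sumrN sum_by_parts opprK; apply: eq_bigr => k _.
    by rewrite expr2 mulrCA.
  rewrite /f; under eq_bigr do rewrite mulrBl.
  by rewrite sumrB phiVw subrr.
have df0 k : dplus d f k = 0.
  move: energy0 => /eqP; rewrite psumr_eq0; last first.
    by move=> i _; rewrite mulr_ge0 ?sqr_ge0 // ltW.
  move=> /allP /(_ k (mem_index_enum k)) /=.
  by rewrite mulf_eq0 gt_eqF //= sqrf_eq0 => /eqP.
have dphi k : dplus d phi k = dplus d V k.
  by apply/eqP; rewrite -subr_eq0 -(df0 k) /dplus /f; apply/eqP; ring.
by move=> k; rewrite vphi; congr (- _); rewrite /dminus !dphi.
Qed.

(** * The Fisher information and its gradient *)

Lemma laplaceE (R : realType) (N : nat) (d : R) (f : 'I_N -> R) (k : 'I_N) :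
  laplace d f k = dminus d (dplus d f) k.
Proof.
rewrite /laplace /dminus /dplus ord_predK -mulrBl -mulrA -invfM -expr2.
by congr (_ / _); ring.
Qed.

(** The variational derivative of the Fisher information at positive rho. *)
Definition fisher_varder {R : realType} {N : nat} (d : R) (rho : 'I_N -> R) :
    'I_N -> R :=
  fun k => - 2 * (laplace d (fun l => Num.sqrt (rho l)) k / Num.sqrt (rho k)).

(** The chain rule along an arbitrary curve: moving one coordinate gives the
    variational derivative, and moving along a line gives the differential. *)
Lemma is_derive_fisher (R : realType) (N : nat) (d : R) (t : R)
    (c : R -> 'I_N -> R) (dc : 'I_N -> R) :
  d != 0 -> (forall k, 0 < c t k) ->
  (forall k, is_derive t (1 : R) (c ^~ k) (dc k)) ->
  is_derive t (1 : R) (fun s => fisher d (c s))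
    (d * \sum_k fisher_varder d (c t) k * dc k).
Proof.
move=> d0 c_gt0 cdc.
pose s x k : R := Num.sqrt (c x k); pose ds k := dc k / (2 * s t k).
have s0 k : s t k != 0 by rewrite gt_eqF // sqrtr_gt0.
have sds k : is_derive t (1 : R) (s ^~ k) (ds k).
  rewrite /ds mulrC.
  by have := @is_derive1_comp _ Num.sqrt (c ^~ k) t _ _ (is_derive1_sqrt (c_gt0 k)) (cdc k).
have -> : (fun x => fisher d (c x)) =
    (2 * d) *: \sum_(k < N) (d^-1 *: ((s ^~ (ordS k)) - (s ^~ k))) ^+ 2.
  apply/funext => x; rewrite /fisher /= fctE; congr (_ * _).
  rewrite fct_sumE; apply: eq_bigr => k _.
  by rewrite exprfctE mulrC.
apply: is_derive_eq.
rewrite /GRing.scale /=.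
(* The derivative of s is dc / (2 s); the sum below is the polarized Dirichlet
   form of s and its derivative, which is then summed by parts. *)
transitivity (4 * d * \sum_k dplus d ds k * dplus d (s t) k).
  rewrite !mulr_sumr; apply: eq_bigr => k _.
  by rewrite expr1 -[_ *: _]/(d^-1 * (s t (ordS k) - s t k)) /dplus; field.
rewrite -[X in _ * X]opprK -sum_by_parts -sumrN !mulr_sumr.
apply: eq_bigr => k _; rewrite -laplaceE.
rewrite -[fisher_varder _ _ k]/(- 2 * (laplace d (s t) k / s t k)) /ds.
by field; rewrite s0.
Qed.

Lemma varder_fisher (R : realType) (N : nat) (d : R) (rho : 'I_N -> R) :
  d != 0 -> (forall k, 0 < rho k) ->
  varder d (fisher d) rho =1 fisher_varder d rho.
Proof.
move=> d0 rho_gt0 k; rewrite /varder derive1E.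
pose c (s : R) (j : 'I_N) := if j == k then s else rho j.
pose dc (j : 'I_N) : R := (j == k)%:R.
have c_rho : c (rho k) = rho.
  by apply/funext => j; rewrite /c; case: eqP => // ->.
have cdc j : is_derive (rho k) (1 : R) (c ^~ j) (dc j).
  by rewrite /c /dc; case: eqP => _; [exact: is_derive_id|exact: is_derive_cst].
have [|_ ->] := @is_derive_fisher R N d (rho k) c dc d0 _ cdc.
  by rewrite c_rho.
rewrite c_rho (bigD1 k) //= big1 ?addr0 => [|j /negPf jk]; last first.
  by rewrite /dc jk mulr0.
by rewrite /dc eqxx mulr1 mulKf.
Qed.

Lemma wflow_fisher (R : realType) (N : nat) (d : R) (rho : 'I_N -> R) :
  d != 0 -> (forall k, 0 < rho k) ->
  wflow geomean d (fisher d) rho =1 dlss_potential_form d rho.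
Proof.
move=> d0 rho_gt0 k; rewrite /wflow /dlss_potential_form.
rewrite /dminus /dplus !varder_fisher // /fisher_varder /mobility /geomean.
by ring.
Qed.

(** The only property of rho behind this identity is that it is the square of
    the nowhere vanishing s; in terms of s both sides are the same rational
    function of the values of s at the five indices around k. *)
Lemma dlss_potential_formE (R : realType) (N : nat) (d : R) (rho : 'I_N -> R) :
  d != 0 -> (forall k, 0 < rho k) -> dlss d rho =1 dlss_potential_form d rho.
Proof.
move=> d0 rho_gt0 k.
pose s j := Num.sqrt (rho j).
have s0 j : s j != 0 by rewrite gt_eqF // sqrtr_gt0.
have sM i j : Num.sqrt (rho i * rho j) = s i * s j by rewrite sqrtrM // ltW.
have ss j : rho j = s j ^+ 2 by rewrite sqr_sqrtr // ltW.
rewrite /dlss /dlss_potential_form /dminus /dplus /laplace !sM !ordSK !ord_predK.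
rewrite -!/(s _) !ss.
by field; rewrite d0 !s0.
Qed.

Lemma is_gradient_fisher (R : realType) (N : nat) (d : R)
    (rho v : 'I_N -> R) :
  0 < d -> (forall k, 0 < rho k) ->
  is_gradient (wasserstein N geomean d) (fisher d) rho v <->
  v = (fun k => - dlss d rho k).
Proof.
move=> d_gt0 rho_gt0; have d0 : d != 0 by rewrite gt_eqF.
have m_gt0 k : 0 < mobility geomean rho k.
  by rewrite /mobility /geomean sqrtr_gt0 mulr_gt0.
have dF (w : 'I_N -> R) : is_derive (0 : R) (1 : R)
    (fun t : R => fisher d (fun k => rho k + t * w k))
    (d * \sum_k fisher_varder d rho k * w k).
  have rho0 : (fun k => rho k + 0 * w k) = rho.
    by apply/funext => k; rewrite mul0r addr0.
  rewrite -{2}rho0.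
  apply: (@is_derive_fisher R N d 0 (fun t k => rho k + t * w k)) => // k.
    by rewrite mul0r addr0.
  by apply: is_derive_eq; rewrite scaler0 !add0r mul1r; exact: mulr1.
apply: (iff_trans (is_gradient_wasserstein _ _ _ _ _ _ _ _ d_gt0 m_gt0 dF)).
have flowE k : dminus d (fun j => mobility geomean rho j *
    dplus d (fisher_varder d rho) j) k = dlss d rho k.
  rewrite dlss_potential_formE // -wflow_fisher // /wflow /dminus /dplus.
  by rewrite !varder_fisher.
split=> [vV|-> k]; last by rewrite flowE.
by apply/funext => k; rewrite vV flowE.
Qed.

(** * The gradient flow *)

Theorem lemma19 (R : realType) (N : nat) (N_gt0 : (0 < N)%N)
    (d : R) (dE : d = N%:R^-1) :
  (forall (J : interval R) (c : R -> 'I_N -> R),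
     positive_solution d (dlss d) J c <->
     gradient_flow (wasserstein N geomean d) (fisher d) J c)
  /\
  (forall rho : 'I_N -> R, pos_prob d rho ->
     dlss d rho =1 wflow geomean d (fisher d) rho /\
     wflow geomean d (fisher d) rho =1 dlss_potential_form d rho).
Proof.
have d_gt0 : 0 < d by rewrite dE invr_gt0 ltr0n.
have d0 : d != 0 by rewrite gt_eqF.
split=> [J c|rho [rho_gt0 _]]; last first.
  by split=> k; rewrite wflow_fisher // dlss_potential_formE.
split=> -[cJ c_cont dc]; split=> // t tJ.
  have [c_gt0 _] := cJ t (interior_subset tJ).
  exists (fun k => - dlss d (c t) k).
    by move=> k; rewrite opprK; exact: dc.
  exact/is_gradient_fisher.
have [c_gt0 _] := cJ t (interior_subset tJ).
move=> k; have [v dcv /is_gradient_fisher vE] := dc t tJ.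
by have := dcv k; rewrite vE // opprK.
Qed.
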